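(* Let $A=KQ/I$ be a gentle algebra over an algebraically closed field $K$ whose quiver $Q$ is of type $\widetilde{\mathbb{A}}_n$, i.e. the underlying graph of $Q$ is a single cycle with $n$ vertices $1,\dots,n$ and $n$ edges (arbitrary orientation). Then the trivial extension $T(A)=A\ltimes DA$ is a Brauer cycle algebra if and only if $\mathrm{rad}^2 A=0$.
   Context: $D=\mathrm{Hom}_K(-,K)$; $T(A)$ has underlying space $A\oplus DA$ with multiplication $(a,f)(b,g)=(ab,ag+fb)$. Gentle: every vertex of $Q$ has at most two incoming and at most two outgoing arrows; for each arrow $\alpha$ there is at most one arrow $\beta$ with $\alpha\beta\in I$, at most one $\gamma$ with $\gamma\alpha\in I$, at most one $\beta'$ with $\alpha\beta'\notin I$ and at most one $\gamma'$ with $\gamma'\alpha\notin I$ (composable arrows); $I$ is admissible and generated by paths of length 2. A Brauer cycle algebra is the Brauer graph algebra, with all multiplicities equal to $1$, of a graph $G$ that is a cycle with $n$ edges; concretely it is $KQ'/I'$ where $Q'$ has vertices $1,\dots,n$ (indices mod $n$), arrows $\alpha_i:i\to i+1$ and $\beta_i:i+1\to i$, and $I'=\langle \alpha_i\alpha_{i+1},\ \beta_{i+1}\beta_i,\ \beta_i\alpha_i-\alpha_{i+1}\beta_{i+1}\ (\text{all } i \bmod n)\rangle$. *)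

(* Defs.v *)
From HB Require Import structures.
From mathcomp Require Import all_boot all_order all_algebra all_field.
Set Implicit Arguments. Unset Strict Implicit. Unset Printing Implicit Defensive.
Import GRing.Theory.
Local Open Scope ring_scope.

Record quiver := Quiver { qV : finType; qA : finType; qs : qA -> qV; qt : qA -> qV }.

(* a path is a start vertex together with a sequence of arrows;
   arrows are composed left to right: [a; b] means "a then b" *)
Definition qpath (Q : quiver) := (qV Q * seq (qA Q))%type.

Fixpoint chain (Q : quiver) (v : qV Q) (s : seq (qA Q)) : bool :=
  match s with [::] => true | a :: s' => (qs a == v) && chain (qt a) s' end.
Definition is_path (Q : quiver) (p : qpath Q) := chain p.1 p.2.
Definition pstart (Q : quiver) (p : qpath Q) := p.1.
Definition pend (Q : quiver) (p : qpath Q) := foldl (fun _ a => qt a) p.1 p.2.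

Definition kq (K : fieldType) (Q : quiver) := seq (K * qpath Q).
Definition kq_valid (K : fieldType) (Q : quiver) (f : kq K Q) := all (fun x => is_path x.2) f.
Definition kq_coef (K : fieldType) (Q : quiver) (f : kq K Q) (p : qpath Q) : K := \sum_(x <- f | x.2 == p) x.1.
Definition kq_scale (K : fieldType) (Q : quiver) (c : K) (f : kq K Q) : kq K Q := [seq (c * x.1, x.2) | x <- f].
Definition kq_mul (K : fieldType) (Q : quiver) (f g : kq K Q) : kq K Q :=
  flatten [seq [seq (x.1 * y.1, (x.2.1, x.2.2 ++ y.2.2)) | y <- g & pend x.2 == pstart y.2]
          | x <- f].
Definition kq_one (K : fieldType) (Q : quiver) : kq K Q := [seq (1, (v, [::])) | v <- enum (qV Q)].
Definition kq_path (K : fieldType) (Q : quiver) (p : qpath Q) : kq K Q := [:: (1, p)].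

Definition in_ideal (K : fieldType) (Q : quiver) (gens : seq (kq K Q)) (f : kq K Q) : Prop :=
  kq_valid f /\
  exists ts : seq (kq K Q * kq K Q * kq K Q),
    (forall t, t \in ts -> [/\ kq_valid t.1.1, t.1.2 \in gens & kq_valid t.2]) /\
    kq_coef f =1 kq_coef (flatten [seq kq_mul (kq_mul t.1.1 t.1.2) t.2 | t <- ts]).

Definition kq_alg_hom (K : fieldType) (Q : quiver) (B : Type) (add mul : B -> B -> B) (scal : K -> B -> B)
    (zero one : B) (phi : kq K Q -> B) : Prop :=
  [/\ forall f g, kq_valid f -> kq_valid g -> kq_coef f =1 kq_coef g -> phi f = phi g,
      forall f g, kq_valid f -> kq_valid g -> phi (f ++ g) = add (phi f) (phi g),
      forall c f, kq_valid f -> phi (kq_scale c f) = scal c (phi f),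
      forall f g, kq_valid f -> kq_valid g -> phi (kq_mul f g) = mul (phi f) (phi g)
    & phi [::] = zero /\ phi (kq_one K Q) = one].

Definition presented_by (K : fieldType) (Q : quiver) (gens : seq (kq K Q)) (B : Type) (add mul : B -> B -> B)
    (scal : K -> B -> B) (zero one : B) : Prop :=
  exists phi : kq K Q -> B,
    [/\ kq_alg_hom add mul scal zero one phi,
        (forall b, exists f, kq_valid f /\ phi f = b) &
        (forall f, kq_valid f -> (phi f = zero <-> in_ideal gens f))].

Definition len2 (K : fieldType) (Q : quiver) (a b : qA Q) : kq K Q := kq_path K (qs a, [:: a; b]).
Definition rel_gens (K : fieldType) (Q : quiver) (rel : seq (qA Q * qA Q)) : seq (kq K Q) :=
  [seq len2 K ab.1 ab.2 | ab <- rel].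

Definition gentle (K : fieldType) (Q : quiver) (rel : seq (qA Q * qA Q)) : Prop :=
  let I := in_ideal (rel_gens K rel) in
  [/\ (forall ab, ab \in rel -> qt ab.1 = qs ab.2),
      (forall v : qV Q, #|[pred a | qt a == v]| <= 2 /\ #|[pred a | qs a == v]| <= 2)%N,
      (forall a b1 b2, qt a = qs b1 -> qt a = qs b2 ->
          I (len2 K a b1) -> I (len2 K a b2) -> b1 = b2) /\
      (forall a c1 c2, qt c1 = qs a -> qt c2 = qs a ->
          I (len2 K c1 a) -> I (len2 K c2 a) -> c1 = c2),
      (forall a b1 b2, qt a = qs b1 -> qt a = qs b2 ->
          ~ I (len2 K a b1) -> ~ I (len2 K a b2) -> b1 = b2) /\
      (forall a c1 c2, qt c1 = qs a -> qt c2 = qs a ->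
          ~ I (len2 K c1 a) -> ~ I (len2 K c2 a) -> c1 = c2)
    & (* admissible: R^m <= I (<= R^2 holds as I is generated by length-2 paths) *)
      exists m : nat, (2 <= m)%N /\
        forall p : qpath Q, is_path p -> (m <= size p.2)%N -> I (kq_path K p)].

Definition cycle_quiver (n : nat) (o : 'I_n -> bool) : quiver :=
  @Quiver 'I_n 'I_n (fun i => if o i then i else ordS i) (fun i => if o i then ordS i else i).

Definition brauer_quiver (m : nat) : quiver :=
  @Quiver 'I_m ('I_m + 'I_m)%type
    (fun x => match x with inl i => i | inr i => ordS i end)
    (fun x => match x with inl i => ordS i | inr i => i end).

Definition brauer_rels (K : fieldType) (m : nat) : seq (kq K (brauer_quiver m)) :=
  flatten [seq [::
                   kq_path K ((i : qV (brauer_quiver m)), [:: inl i; inl (ordS i)]);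
                   kq_path K (ordS (ordS i) : qV (brauer_quiver m), [:: inr (ordS i); inr i]);
                   [:: (1, (ordS i : qV (brauer_quiver m), [:: inr i; inl i]));
                       (-1, (ordS i : qV (brauer_quiver m), [:: inl (ordS i); inr (ordS i)]))]]
          | i <- enum 'I_m].

Definition is_brauer_cycle (K : fieldType) (B : Type) (add mul : B -> B -> B)
    (scal : K -> B -> B) (zero one : B) : Prop :=
  exists m : nat, (0 < m)%N /\ presented_by (brauer_rels K m) add mul scal zero one.

Section TrivExt.
Variables (K : fieldType) (A : falgType K).
Definition DA := 'Hom(A, K^o).
Definition TA := (A * DA)%type.
Definition dl (a : A) (g : DA) : DA := linfun (fun x : A => g (x * a) : K^o).
Definition dr (f : DA) (b : A) : DA := linfun (fun x : A => f (b * x) : K^o).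
Definition T_add (u v : TA) : TA := (u.1 + v.1, u.2 + v.2).
Definition T_scal (c : K) (u : TA) : TA := (c *: u.1, c *: u.2).
Definition T_mul (u v : TA) : TA := (u.1 * v.1, dl u.1 v.2 + dr u.2 v.1).
Definition T_zero : TA := (0, 0).
Definition T_one : TA := (1, 0).
End TrivExt.

Definition left_ideal (K : fieldType) (A : falgType K) (L : {vspace A}) : Prop :=
  forall a x : A, x \in L -> a * x \in L.
Definition maximal_left_ideal (K : fieldType) (A : falgType K) (L : {vspace A}) : Prop :=
  [/\ left_ideal L, L != fullv &
      forall W : {vspace A}, left_ideal W -> (L <= W)%VS -> W = L \/ W = fullv].
Definition in_rad (K : fieldType) (A : falgType K) (x : A) : Prop :=
  forall L : {vspace A}, maximal_left_ideal L -> x \in L.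
Definition rad_sq_zero (K : fieldType) (A : falgType K) : Prop :=
  forall x y : A, in_rad x -> in_rad y -> x * y = 0.

(* Main.v *)
(* Both directions turn on whether A has the basis consisting of the n vertex
   idempotents and the n arrows only. These 2n elements are always linearly
   independent, because the relations are combinations of paths of length at
   least 2.

   If T(A) is the Brauer cycle algebra with m edges, then rewriting paths gives
   dim T(A) <= 4m. Its m vertex idempotents survive modulo the nilpotent elements
   of T(A), and modulo these T(A) is spanned by the n idempotents of A, so m <= n.
   Hence 2 dim A = dim T(A) <= 4n and the 2n elements are a basis of A; products
   of two arrows then vanish, and so does rad^2 A.

   If rad^2 A = 0, then products of two arrows vanish since arrows lie in the
   radical, so the 2n elements are again a basis. With the dual basis of DA, send
   one of alpha_i, beta_i (according to the orientation of the edge i) to the arrow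
   i and the other to its dual vector: the products alpha_i beta_i and
   beta_{i-1} alpha_{i-1} are both the dual vector of the idempotent i. *)
Require Import Defs.
From HB Require Import structures.
From mathcomp Require Import all_boot all_order all_algebra all_field.
From mathcomp Require Import ring.
Set Implicit Arguments. Unset Strict Implicit. Unset Printing Implicit Defensive.
Import GRing.Theory.
Local Open Scope ring_scope.

(** * Path algebras and their quotients *)

Section FreeModule.
Variables (K : fieldType) (Q : quiver).
Implicit Types (f g h : kq K Q) (p q : qpath Q) (c : K).

(** Elements of [kq] are unreduced lists of terms, so a linear map given on paths is evaluated term
    by term, repetitions included. *)
Definition kq_ext (V : lmodType K) (L : qpath Q -> V) f : V :=
  \sum_(x <- f) x.1 *: L x.2.

Section Ext.
Variables (V : lmodType K) (L : qpath Q -> V).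

Lemma kq_ext_cat f g : kq_ext L (f ++ g) = kq_ext L f + kq_ext L g.
Proof. by rewrite /kq_ext big_cat. Qed.

Lemma kq_ext_scale c f : kq_ext L (kq_scale c f) = c *: kq_ext L f.
Proof.
by rewrite /kq_ext big_map scaler_sumr; apply: eq_bigr => x _; rewrite scalerA.
Qed.

Lemma kq_ext_path p : kq_ext L (kq_path K p) = L p.
Proof. by rewrite /kq_ext big_seq1 scale1r. Qed.

Lemma kq_ext_coef_sum (s : seq (qpath Q)) f :
  uniq s -> {subset [seq x.2 | x <- f] <= s} ->
  kq_ext L f = \sum_(p <- s) kq_coef f p *: L p.
Proof.
move=> us sub; rewrite /kq_ext /kq_coef.
under [RHS]eq_bigr => p _.
  rewrite scaler_suml big_mkcond /=.
  over.
rewrite exchange_big /= [LHS]big_seq [RHS]big_seq; apply: eq_bigr => x xf.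
rewrite (bigD1_seq x.2) ?sub ?map_f //= eqxx big1 ?addr0 // => q qx.
by rewrite eq_sym (negbTE qx).
Qed.

(** Both lists are regrouped over one duplicate-free list of paths, where only coefficients enter.
    This makes [kq_ext] well defined on the path algebra, whose equality is equality of
    coefficients. *)
Lemma kq_ext_coef f g : kq_coef f =1 kq_coef g -> kq_ext L f = kq_ext L g.
Proof.
move=> fg; pose s := undup ([seq x.2 | x <- f] ++ [seq x.2 | x <- g]).
rewrite !(@kq_ext_coef_sum s) ?undup_uniq //; first last.
- by move=> x xf; rewrite mem_undup mem_cat xf.
- by move=> x xf; rewrite mem_undup mem_cat xf orbT.
by apply: eq_bigr => p _; rewrite fg.
Qed.

Lemma kq_ext_mul f g :
  kq_ext L (kq_mul f g) = \sum_(x <- f) \sum_(y <- g | pend x.2 == pstart y.2)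
    (x.1 * y.1) *: L (x.2.1, x.2.2 ++ y.2.2).
Proof.
rewrite /kq_ext /kq_mul big_flatten big_map; apply: eq_bigr => x _.
by rewrite big_map big_filter.
Qed.

End Ext.

(** A coefficient is itself a linear extension, so its additivity and homogeneity come from those of
    [kq_ext]. *)
Lemma kq_coefE f p :
  kq_coef f p = kq_ext (fun q => (q == p)%:R : (K^o : lmodType K)) f.
Proof.
rewrite /kq_coef /kq_ext big_mkcond; apply: eq_bigr => x _.
rewrite -[_ *: _]/(x.1 * _); case: eqP => _ /=; rewrite ?mulr1n ?mulr0n ?mulr1 //.
by rewrite mulr0.
Qed.

Lemma kq_coef_cat f g p : kq_coef (f ++ g) p = kq_coef f p + kq_coef g p.
Proof. by rewrite !kq_coefE kq_ext_cat. Qed.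

Lemma kq_coef_scale c f p : kq_coef (kq_scale c f) p = c * kq_coef f p.
Proof. by rewrite !kq_coefE kq_ext_scale. Qed.

Lemma kq_coef_cons (x : K * qpath Q) f p :
  kq_coef (x :: f) p = x.1 * (x.2 == p)%:R + kq_coef f p.
Proof.
rewrite /kq_coef big_cons; case: eqP => _; first by rewrite mulr1.
by rewrite mulr0 add0r.
Qed.

Lemma kq_coef_nil p : kq_coef ([::] : kq K Q) p = 0.
Proof. by rewrite /kq_coef big_nil. Qed.

Definition coefE := (kq_coef_cat, kq_coef_scale, kq_coef_cons, kq_coef_nil).

Lemma kq_coef_notin f p : p \notin [seq x.2 | x <- f] -> kq_coef f p = 0.
Proof.
move=> pf; rewrite /kq_coef big_seq_cond big1 // => x /andP[xf /eqP xp].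
by rewrite -xp map_f in pf.
Qed.

Lemma pend_cat v s1 s2 :
  pend ((v, s1 ++ s2) : qpath Q) = pend (pend ((v, s1) : qpath Q), s2).
Proof. by rewrite /pend /= foldl_cat. Qed.

Lemma chain_cat (v : qV Q) (s1 s2 : seq (qA Q)) :
  chain v (s1 ++ s2) = chain v s1 && chain (pend ((v, s1) : qpath Q)) s2.
Proof. by elim: s1 v => //= a s IH v; rewrite IH andbA. Qed.

Lemma kq_valid_cat f g : kq_valid (f ++ g) = kq_valid f && kq_valid g.
Proof. exact: all_cat. Qed.

Lemma kq_valid_scale c f : kq_valid (kq_scale c f) = kq_valid f.
Proof. by rewrite /kq_valid all_map. Qed.

Lemma kq_valid_path p : kq_valid (kq_path K p) = is_path p.
Proof. by rewrite /kq_valid /= andbT. Qed.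

Lemma kq_valid_mul f g : kq_valid f -> kq_valid g -> kq_valid (kq_mul f g).
Proof.
move=> /allP vf /allP vg; apply/allP => z /flatten_mapP[x xf /mapP[y]].
rewrite mem_filter => /andP[/eqP e yg] ->; move: (vf _ xf) (vg _ yg).
by case: x y e {xf yg} => [c [v s]] [d [w t]] /= e; rewrite /is_path /= chain_cat e => -> ->.
Qed.

Lemma kq_valid_one : kq_valid (kq_one K Q).
Proof. by apply/allP => x /mapP[v _ ->]. Qed.

Lemma kq_mul_path p q : pend p = pstart q ->
  kq_mul (kq_path K p) (kq_path K q) = kq_path K (p.1, p.2 ++ q.2).
Proof. by move=> e; rewrite /kq_mul /= e eqxx /= mulr1. Qed.

Lemma kq_mul_path0 p q : pend p != pstart q ->
  kq_mul (kq_path K p) (kq_path K q) = [::].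
Proof. by move=> /negbTE e; rewrite /kq_mul /= e. Qed.

Lemma kq_mul_scalel c f g : kq_mul (kq_scale c f) g = kq_scale c (kq_mul f g).
Proof.
rewrite /kq_mul /kq_scale -map_comp map_flatten -map_comp; congr flatten.
apply: eq_map => x /=; rewrite -map_comp; apply: eq_map => y /=.
by rewrite mulrA.
Qed.

(** The [k]-th power of the arrow ideal, tested on the listed terms, even on those that cancel. *)
Definition kq_long (k : nat) f := all (fun x : K * qpath Q => k <= size x.2.2)%N f.

Lemma kq_long_mul k l f g : kq_long k f -> kq_long l g -> kq_long (k + l) (kq_mul f g).
Proof.
move=> /allP lf /allP lg; apply/allP => z /flatten_mapP[x xf /mapP[y]].
rewrite mem_filter => /andP[_ yg] ->.
by rewrite size_cat leq_add // ?lf ?lg.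
Qed.

Lemma kq_long0 f : kq_long 0 f. Proof. exact/allP. Qed.

Lemma kq_long_coef k f p : kq_long k f -> (size p.2 < k)%N -> kq_coef f p = 0.
Proof.
move=> /allP lf sp; apply: kq_coef_notin; apply/mapP => -[x xf e].
by move: (lf _ xf); rewrite -e leqNgt sp.
Qed.

End FreeModule.

(** * Two-sided ideals of a path algebra given by generators *)

Section Ideal.
Variables (K : fieldType) (Q : quiver) (gens : seq (kq K Q)).
Implicit Types (f g h : kq K Q) (p q : qpath Q) (c : K).
Local Notation I := (in_ideal gens).

Lemma in_ideal_coef f g : kq_valid g -> kq_coef f =1 kq_coef g -> I f -> I g.
Proof.
move=> vg fg [_ [ts [H e]]]; split=> //; exists ts; split=> // p.
by rewrite -fg e.
Qed.

Lemma in_ideal0 : I [::].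
Proof. by split=> //; exists [::]; split. Qed.

Lemma in_ideal_cat f g : I f -> I g -> I (f ++ g).
Proof.
move=> [vf [ts [Hs es]]] [vg [tt [Ht et]]]; split; first by rewrite kq_valid_cat vf.
exists (ts ++ tt); split.
  by move=> t; rewrite mem_cat => /orP[/Hs|/Ht].
by move=> p; rewrite map_cat flatten_cat !kq_coef_cat es et.
Qed.

Lemma in_ideal_scale c f : I f -> I (kq_scale c f).
Proof.
move=> [vf [ts [Hs es]]]; split; first by rewrite kq_valid_scale.
exists [seq (kq_scale c t.1.1, t.1.2, t.2) | t <- ts]; split.
  by move=> t /mapP[u /Hs[? ? ?] ->]; split; rewrite //= kq_valid_scale.
move=> p; rewrite kq_coef_scale es -kq_coef_scale; congr (kq_coef _ p).
rewrite -map_comp /kq_scale map_flatten -map_comp; congr flatten.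
by apply: eq_map => t /=; rewrite -!/(kq_scale _ _) !kq_mul_scalel.
Qed.

Lemma in_ideal_mul f g h : kq_valid f -> g \in gens -> kq_valid g -> kq_valid h ->
  I (kq_mul (kq_mul f g) h).
Proof.
move=> vf gg vg vh; split; first by rewrite !kq_valid_mul.
exists [:: (f, g, h)]; split; last by move=> p /=; rewrite cats0.
by move=> t; rewrite inE => /eqP ->.
Qed.

(** Multiplication by paths never shortens a term, so the ideal stays inside the [k]-th power of the
    arrow ideal. For [k = 2] this keeps vertices and arrows independent in the quotient. *)
Lemma in_ideal_short k f p :
  {in gens, forall g, kq_long k g} -> I f -> (size p.2 < k)%N -> kq_coef f p = 0.
Proof.
move=> lg [_ [ts [H e]]] sp; rewrite e; apply: (kq_long_coef (k := k)) => //.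
apply/allP => x /flatten_mapP[t /H[_ /lg lt _]].
have := kq_long_mul (kq_long_mul (kq_long0 t.1.1) lt) (kq_long0 t.2).
by rewrite add0n addn0 => /allP; apply.
Qed.

End Ideal.

(** * Algebra homomorphisms out of a path algebra *)

Section Hom.
Variables (K : fieldType) (Q : quiver) (B : algType K).
Implicit Types (f g h : kq K Q) (p q : qpath Q) (c : K).

Definition alg_hom (phi : kq K Q -> B) :=
  kq_alg_hom +%R *%R *:%R (0 : B) 1 phi.

Lemma alg_hom_ext phi f : alg_hom phi -> kq_valid f ->
  phi f = kq_ext (fun p => phi (kq_path K p)) f.
Proof.
move=> [hc hD hZ hM [h0 h1]]; elim: f => [|x f IH] vf; first by rewrite h0 /kq_ext big_nil.
move: vf => /= /andP[vx vf]; rewrite -cat1s kq_ext_cat hD //=; last by rewrite vx.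
rewrite IH //; congr (_ + _).
have -> : [:: x] = kq_scale x.1 (kq_path K x.2) by rewrite /= mulr1 -surjective_pairing.
by rewrite hZ ?kq_valid_path // kq_ext_scale kq_ext_path.
Qed.

Lemma alg_hom_mul_path phi p q : alg_hom phi -> is_path p -> is_path q ->
  phi (kq_path K p) * phi (kq_path K q) =
  if pend p == pstart q then phi (kq_path K (p.1, p.2 ++ q.2)) else 0.
Proof.
move=> [_ _ _ hM [h0 _]] vp vq; rewrite -hM ?kq_valid_path //.
by case: eqP => [e|/eqP e]; [rewrite kq_mul_path | rewrite kq_mul_path0].
Qed.

Lemma alg_hom_one phi : alg_hom phi -> \sum_v phi (kq_path K (v, [::])) = 1.
Proof.
move=> hphi; have [_ _ _ _ [_ <-]] := hphi.
rewrite (alg_hom_ext hphi (kq_valid_one _ _)) /kq_ext /kq_one big_map big_enum.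
by apply: eq_bigr => v _; rewrite scale1r.
Qed.

Lemma alg_hom_flatten phi (s : seq (kq K Q)) : alg_hom phi -> all (@kq_valid K Q) s ->
  phi (flatten s) = \sum_(f <- s) phi f.
Proof.
move=> [hc hD hZ hM [h0 h1]]; elim: s => [|f s IH] /=; first by rewrite big_nil.
move=> /andP[vf vs]; rewrite hD ?IH ?big_cons //.
by elim: (s) vs => //= g t IHt /andP[vg /IHt]; rewrite kq_valid_cat vg.
Qed.

Lemma alg_hom_ideal phi gens f : alg_hom phi ->
  {in gens, forall g, kq_valid g /\ phi g = 0} -> in_ideal gens f -> phi f = 0.
Proof.
move=> hphi hg [vf [ts [H e]]]; have [hc hD hZ hM [h0 h1]] := hphi.
have vt t : t \in ts -> kq_valid (kq_mul (kq_mul t.1.1 t.1.2) t.2).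
  by move=> /H[? /hg[? _] ?]; rewrite !kq_valid_mul.
have va : all (@kq_valid K Q) [seq kq_mul (kq_mul t.1.1 t.1.2) t.2 | t <- ts].
  by apply/allP => g /mapP[t /vt ? ->].
rewrite (hc _ _ vf _ e); last first.
  by apply/allP => x /flatten_mapP[t /vt/allP]; apply.
rewrite alg_hom_flatten // big_map big_seq big1 // => t /H[v1 /hg[v2 e2] v3].
by rewrite !hM ?kq_valid_mul // e2 mulr0 mul0r.
Qed.

Section Universal.
Variables (E : qV Q -> B) (W : qA Q -> B).
Hypotheses (EE : forall v w, E v * E w = if v == w then E v else 0)
  (E1 : \sum_v E v = 1)
  (WE : forall a, W a * E (qt a) = W a).

(** The universal property of the path algebra: orthogonal idempotents with sum 1 and compatible
    images of arrows determine a homomorphism. The leading idempotent gives the trivial path at a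
    vertex its value. *)
Definition path_val p : B := E p.1 * \prod_(a <- p.2) W a.

Lemma path_val_end p : is_path p -> path_val p * E (pend p) = path_val p.
Proof.
case: p => v s; rewrite /path_val /is_path /=.
elim: s v => [|a s IH] v /=; first by rewrite big_nil mulr1 EE eqxx.
(* Inserting the idempotent of [qt a] after [W a] turns the remaining product into the value of a
   path starting at [qt a], to which the induction hypothesis applies. *)
move=> /andP[/eqP <- cs]; rewrite big_cons -[W a]WE !mulrA.
by rewrite -!(mulrA (E (qs a) * W a)) [pend _]/(pend (qt a, s)) IH.
Qed.

Lemma path_val_mul p q : is_path p -> path_val p * path_val q =
  if pend p == pstart q then path_val (p.1, p.2 ++ q.2) else 0.
Proof.
move=> vp; rewrite -(path_val_end vp) {2}/path_val mulrA -(mulrA _ (E _) (E _)) EE.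
case: eqP => _; last by rewrite mulr0 mul0r.
by rewrite path_val_end // /path_val big_cat mulrA.
Qed.

Lemma path_val_hom : alg_hom (kq_ext path_val).
Proof.
split.
- by move=> f g _ _; apply: kq_ext_coef.
- by move=> f g _ _; apply: kq_ext_cat.
- by move=> c f _; apply: kq_ext_scale.
- move=> f g /allP vf vg; rewrite kq_ext_mul /kq_ext mulr_suml.
  rewrite big_seq [RHS]big_seq; apply: eq_bigr => x /vf vx.
  rewrite mulr_sumr big_mkcond /=; apply: eq_bigr => y _.
  rewrite -scalerAl -scalerAr scalerA path_val_mul //.
  by case: eqP; rewrite ?scaler0.
split; first by rewrite /kq_ext big_nil.
rewrite /kq_ext /kq_one big_map big_enum -E1; apply: eq_bigr => v _.
by rewrite scale1r /path_val big_nil mulr1.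
Qed.

End Universal.
End Hom.

(** * The trivial extension as an algebra *)

Section TrivialExtension.
Variables (K : fieldType) (A : falgType K).

(** A separate name for the type of pairs, so that it can carry [T_mul] as its ring
    multiplication. *)
Definition triv_ext : Type := (A * 'Hom(A, K^o))%type.
HB.instance Definition _ := Vector.copy triv_ext (A * 'Hom(A, K^o))%type.
Implicit Types (u v w : triv_ext) (a b x : A) (f g : DA A).

Let lin_l a f : linear (fun x => f (x * a) : K^o).
Proof. by move=> c x y; rewrite mulrDl -scalerAl linearP. Qed.

Let lin_r f b : linear (fun x => f (b * x) : K^o).
Proof. by move=> c x y; rewrite mulrDr -scalerAr linearP. Qed.

(** [linfun] computes only on a function known to be linear, so the linear structure is packed
    locally. *)
Lemma dlE a f x : dl a f x = f (x * a).
Proof.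
pose m := GRing.isLinear.Build K A K^o _ _ (lin_l a f).
pose L : {linear A -> K^o} := HB.pack (fun x => f (x * a) : K^o) m.
exact: (lfunE L).
Qed.

Lemma drE f b x : dr f b x = f (b * x).
Proof.
pose m := GRing.isLinear.Build K A K^o _ _ (lin_r f b).
pose L : {linear A -> K^o} := HB.pack (fun x => f (b * x) : K^o) m.
exact: (lfunE L).
Qed.

Lemma triv_ext_eq u v : u.1 = v.1 -> (forall x, u.2 x = v.2 x) -> u = v.
Proof. by case: u v => [a f] [b g] /= -> /lfunP ->. Qed.

Let one : triv_ext := T_one A.
Let mul : triv_ext -> triv_ext -> triv_ext := @T_mul K A.

Fact triv_ext_mulA : associative mul.
Proof.
move=> u v w; apply: triv_ext_eq => [|x] /=; first by rewrite mulrA.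
by rewrite !lfunE /= !(dlE, drE) !lfunE /= !(dlE, drE) addrA !mulrA.
Qed.

Fact triv_ext_mul1 : left_id one mul.
Proof.
move=> u; apply: triv_ext_eq => [|x] /=; first by rewrite mul1r.
by rewrite lfunE /= dlE drE mulr1 lfunE addr0.
Qed.

Fact triv_ext_mulr1 : right_id one mul.
Proof.
move=> u; apply: triv_ext_eq => [|x] /=; first by rewrite mulr1.
by rewrite lfunE /= dlE drE mul1r lfunE add0r.
Qed.

Fact triv_ext_mulDl : left_distributive mul +%R.
Proof.
move=> u v w; apply: triv_ext_eq => [|x] /=; first by rewrite mulrDl.
by rewrite !lfunE /= !(dlE, drE) !lfunE /= !(dlE, drE) mulrDr linearD addrACA.
Qed.

Fact triv_ext_mulDr : right_distributive mul +%R.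
Proof.
move=> u v w; apply: triv_ext_eq => [|x] /=; first by rewrite mulrDr.
by rewrite !lfunE /= !(dlE, drE) !lfunE /= !(dlE, drE) mulrDl linearD addrACA.
Qed.

Fact triv_ext_1neq0 : one != 0.
Proof. by rewrite -[_ == _]/((1, 0) == (0, 0) :> A * 'Hom(A, K^o)) xpair_eqE oner_eq0. Qed.

HB.instance Definition _ := GRing.Zmodule_isNzRing.Build triv_ext
  triv_ext_mulA triv_ext_mul1 triv_ext_mulr1 triv_ext_mulDl triv_ext_mulDr
  triv_ext_1neq0.

Fact triv_ext_scalerAl (c : K) u v : c *: (u * v) = c *: u * v.
Proof.
apply: triv_ext_eq => [|x] /=; first by rewrite scalerAl.
by rewrite !lfunE /= !(dlE, drE) !lfunE /= !(dlE, drE) scalerDr -scalerAr linearZ.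
Qed.

HB.instance Definition _ := GRing.Lmodule_isLalgebra.Build K triv_ext triv_ext_scalerAl.

Fact triv_ext_scalerAr (c : K) u v : c *: (u * v) = u * (c *: v).
Proof.
apply: triv_ext_eq => [|x] /=; first by rewrite scalerAr.
by rewrite !lfunE /= !(dlE, drE) !lfunE /= !(dlE, drE) scalerDr -scalerAl linearZ.
Qed.

HB.instance Definition _ := GRing.Lalgebra_isAlgebra.Build K triv_ext triv_ext_scalerAr.

Lemma dim_triv_ext : dim triv_ext = (dim A + dim A)%N.
Proof. by rewrite -[LHS]/(dim A + dim A * 1)%N muln1. Qed.

Lemma triv_ext_mul1E u v : (u * v).1 = u.1 * v.1.
Proof. by []. Qed.

Lemma triv_ext_mul2E u v x : (u * v).2 x = v.2 (x * u.1) + u.2 (v.1 * x).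
Proof. by rewrite /= lfunE /= dlE drE. Qed.

End TrivialExtension.

(** The operations of the algebra [triv_ext A] are the [T_] operations by conversion, so general
    facts on algebras apply to the trivial extension. *)
Lemma triv_ext_presented (K : fieldType) (Q : quiver) (gens : seq (kq K Q)) (A : falgType K) :
  presented_by gens (@T_add K A) (@T_mul K A) (@T_scal K A) (T_zero A) (T_one A) =
  presented_by gens +%R *%R *:%R (0 : triv_ext A) 1.
Proof. by []. Qed.

(** * Normal forms in the Brauer cycle algebra *)

Section BrauerNormalForm.
Variables (K : fieldType) (m : nat).
Local Notation Q := (brauer_quiver m).
Local Notation rels := (brauer_rels K m).
Local Notation I := (in_ideal rels).
Implicit Types (f : kq K Q) (p : qpath Q) (s : seq (qA Q)) (v : qV Q) (i : 'I_m).

Lemma brauer_rels_inl i : kq_path K ((i, [:: inl i; inl (ordS i)]) : qpath Q) \in rels.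
Proof. by apply/flatten_mapP; exists i; rewrite ?mem_enum // !inE eqxx. Qed.

Lemma brauer_rels_inr i :
  kq_path K ((ordS (ordS i), [:: inr (ordS i); inr i]) : qpath Q) \in rels.
Proof. by apply/flatten_mapP; exists i; rewrite ?mem_enum // !inE eqxx orbT. Qed.

Definition brauer_comm_rel i : kq K Q :=
  [:: (1, (ordS i, [:: inr i; inl i])); (-1, (ordS i, [:: inl (ordS i); inr (ordS i)]))].

Lemma brauer_rels_comm i : brauer_comm_rel i \in rels.
Proof. by apply/flatten_mapP; exists i; rewrite ?mem_enum // !inE eqxx !orbT. Qed.

Lemma brauer_relsP g : g \in rels -> exists i,
  [\/ g = kq_path K ((i, [:: inl i; inl (ordS i)]) : qpath Q),
      g = kq_path K ((ordS (ordS i), [:: inr (ordS i); inr i]) : qpath Q) |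
      g = brauer_comm_rel i].
Proof.
case/flatten_mapP => i _; rewrite !inE => /or3P[] /eqP ->; exists i;
  [exact: Or31|exact: Or32|exact: Or33].
Qed.

Lemma brauer_rels_valid g : g \in rels -> kq_valid g.
Proof.
by case/brauer_relsP => i [] ->; rewrite /kq_valid /is_path /= ?eqxx.
Qed.

Lemma brauer_rels_long g : g \in rels -> kq_long 2 g.
Proof. by case/brauer_relsP => i [] ->. Qed.

(** Such a path is the relation multiplied by the two outer pieces [s1] and [s2]. *)
Lemma in_ideal_infix v s1 s2 (x y : qA Q) :
  kq_path K ((qs x, [:: x; y]) : qpath Q) \in rels ->
  chain v (s1 ++ [:: x, y & s2]) -> I (kq_path K (v, s1 ++ [:: x, y & s2])).
Proof.
move=> gxy; rewrite chain_cat => /and4P[c1 /eqP ex /eqP ey c2].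
have := in_ideal_mul (f := kq_path K ((v, s1) : qpath Q))
  (h := kq_path K ((qt y, s2) : qpath Q)) _ gxy (brauer_rels_valid gxy) _.
rewrite kq_mul_path // kq_mul_path /=; last by rewrite pend_cat.
by rewrite -catA; apply; rewrite andbT.
Qed.

Definition same_side (x y : qA Q) : bool :=
  match x, y with inl _, inl _ | inr _, inr _ => true | _, _ => false end.

Lemma same_side_rel (x y : qA Q) : same_side x y -> qs y = qt x ->
  kq_path K ((qs x, [:: x; y]) : qpath Q) \in rels.
Proof.
case: x y => [i|i] [j|j] //= _ e; first by rewrite e brauer_rels_inl.
by rewrite -e brauer_rels_inr.
Qed.

Lemma in_ideal_same_side v s1 s2 (x y : qA Q) : same_side x y ->
  chain v (s1 ++ [:: x, y & s2]) -> I (kq_path K (v, s1 ++ [:: x, y & s2])).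
Proof.
move=> xy c; apply: in_ideal_infix => //; apply: same_side_rel => //.
by move: c; rewrite chain_cat => /= /and4P[_ _ /eqP -> _].
Qed.

Lemma in_ideal_comm i s : chain (ordS i : qV Q) s ->
  I [:: (1, (ordS i, [:: inr i, inl i & s]));
        (-1, (ordS i, [:: inl (ordS i), inr (ordS i) & s]))].
Proof.
move=> c; have gi := brauer_rels_comm i.
have := in_ideal_mul (f := kq_path K ((ordS i, [::]) : qpath Q))
  (h := kq_path K ((ordS i, s) : qpath Q)) _ gi (brauer_rels_valid gi) _.
rewrite /kq_mul /= /pend /= /pstart /= !eqxx /= /pend /= !eqxx /= !mul1r !mulr1.
by apply; rewrite ?andbT.
Qed.

(** Two consecutive arrows of the same side give a monomial relation. Otherwise the first three
    arrows alternate, and the commutativity relation applied to the first two creates such a pair in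
    second and third position. *)
Lemma in_ideal_long v s : (2 < size s)%N -> chain v s -> I (kq_path K ((v, s) : qpath Q)).
Proof.
case: s => [|x [|y [|z s]]] // _ c.
case xy: (same_side x y); first exact: (@in_ideal_same_side v [::]).
case yz: (same_side y z); first exact: (@in_ideal_same_side v [:: x]).
case: x xy c => i; case: y yz => // j; case: z => // k _ _ /= /and4P[/eqP ? /eqP ej /eqP ek c].
(* The path begins with alpha, beta, alpha at [i]; its first two arrows are exchanged for beta,
   alpha through the vertex [ord_pred i]. *)
- move: ej => /ordS_inj ?; subst j k v.
  have ci : chain (ordS (ord_pred i) : qV Q) (inl i :: s) by rewrite /= ord_predK eqxx.
  have Ic := in_ideal_comm ci; rewrite ord_predK in Ic.
  have cb : chain (i : qV Q) ([::] ++ [:: inr (ord_pred i), inl (ord_pred i), inl i & s]).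
    by rewrite /= !ord_predK !eqxx.
  have Ib := @in_ideal_same_side i [:: inr (ord_pred i)] s (inl (ord_pred i)) (inl i) isT cb.
  apply: in_ideal_coef (in_ideal_cat Ib (in_ideal_scale (-1) Ic)).
    by rewrite kq_valid_path /is_path /= !eqxx.
  by move=> p; rewrite !coefE /=; ring.
(* The path begins with beta, alpha, beta at [ordS i]; its first two arrows are exchanged for alpha,
   beta on the edge [ordS i]. *)
- move: ek => /ordS_inj ?; subst j k v.
  have ci : chain (ordS i : qV Q) (inr i :: s) by rewrite /= eqxx.
  have Ic := in_ideal_comm ci.
  have cb : chain (ordS i : qV Q) ([::] ++ [:: inl (ordS i), inr (ordS i), inr i & s]).
    by rewrite /= !eqxx.
  have Ib := @in_ideal_same_side (ordS i) [:: inl (ordS i)] s (inr (ordS i)) (inr i) isT cb.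
  apply: in_ideal_coef (in_ideal_cat Ib Ic).
    by rewrite kq_valid_path /is_path /= !eqxx.
  by move=> p; rewrite !coefE /=; ring.
Qed.

(** At each vertex the two cycles of length two agree modulo the relations; the one starting with
    alpha is the chosen representative. The empty list stands for zero. *)
Definition brauer_nf1 p : kq K Q :=
  match p.2 with
  | [::] | [:: _] | [:: inl _; inr _] => kq_path K p
  | [:: inr _; inl _] => kq_path K ((p.1, [:: inl p.1; inr p.1]) : qpath Q)
  | _ => [::]
  end.

Definition brauer_nf f : kq K Q := flatten [seq kq_scale x.1 (brauer_nf1 x.2) | x <- f].

Lemma brauer_nf1P p : is_path p -> I (kq_path K p ++ kq_scale (-1) (brauer_nf1 p)).
Proof.
case: p => v s vp.
have trivial : I (kq_path K (v, s) ++ kq_scale (-1) (kq_path K (v, s))).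
  apply: in_ideal_coef (in_ideal0 _).
    by rewrite kq_valid_cat kq_valid_scale kq_valid_path andbb.
  by move=> p; rewrite !coefE mulN1r subrr.
case: s vp trivial => [|x [|y [|z s]]] // vp trivial; last first.
  have -> : brauer_nf1 (v, [:: x, y, z & s]) = [::] by case: x y {vp trivial} => ? [].
  by rewrite cats0; apply: in_ideal_long.
case: x y vp trivial => i [j|j] // vp trivial; rewrite /brauer_nf1 /= ?cats0.
- exact: (@in_ideal_same_side v [::] [::]).
- move: vp; rewrite /is_path /= => /and3P[/eqP <- /eqP -> _].
  by rewrite mulr1; apply: in_ideal_comm.
- exact: (@in_ideal_same_side v [::] [::]).
- by case: x {vp} trivial.
Qed.

Lemma brauer_nfP f : kq_valid f -> I (f ++ kq_scale (-1) (brauer_nf f)).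
Proof.
elim: f => [|x f IH]; first by move=> _; apply: in_ideal0.
case/andP=> vx vf.
have If := in_ideal_cat (in_ideal_scale x.1 (brauer_nf1P vx)) (IH vf).
apply: in_ideal_coef If; last first.
  move=> p; rewrite -[brauer_nf (x :: f)]/(kq_scale x.1 (brauer_nf1 x.2) ++ brauer_nf f).
  by rewrite !coefE /=; ring.
have [+ _] := brauer_nf1P vx; have [+ _] := IH vf.
rewrite !kq_valid_cat !kq_valid_scale => /andP[_ v1] /andP[_ v2].
rewrite -[brauer_nf (x :: f)]/(kq_scale x.1 (brauer_nf1 x.2) ++ brauer_nf f).
by rewrite kq_valid_cat kq_valid_scale v1 v2 !andbT; apply/andP.
Qed.

(** For the dimension bound only the spanning property matters; the coordinates [coord] on the
    trivial extension later separate these paths. *)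
Definition brauer_basis : seq (qpath Q) :=
  [seq (v, [::]) | v <- enum (qV Q)] ++ [seq (qs g, [:: g]) | g <- enum (qA Q)]
  ++ [seq (v, [:: inl v; inr v]) | v <- enum 'I_m].

Lemma size_brauer_basis : size brauer_basis = (4 * m)%N.
Proof.
have szV : size (enum (qV Q)) = m := size_enum_ord m.
have szA : size (enum (qA Q)) = (m + m)%N.
  by transitivity #|{: 'I_m + 'I_m}|; [rewrite cardT | rewrite card_sum card_ord].
rewrite !size_cat !size_map.
transitivity (m + ((m + m) + m))%N; last by rewrite !mulSn addn0 !addnA.
by congr (_ + (_ + _))%N; rewrite -enumT; [exact: szV | exact: szA | exact: szV].
Qed.

Lemma brauer_basis_valid p : p \in brauer_basis -> is_path p.
Proof.
by rewrite !mem_cat => /or3P[] /mapP[x _ ->]; rewrite /is_path /= ?eqxx.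
Qed.

Lemma brauer_nf_basis f x : kq_valid f -> x \in brauer_nf f -> x.2 \in brauer_basis.
Proof.
move=> /allP vf /flatten_mapP[[c p] /vf vp /mapP[y + ->]] {x vf} /=.
move: vp; rewrite /=; case: p => v s /=; rewrite /is_path /brauer_nf1 /=.
rewrite !mem_cat; case: s => [|a [|b [|d s]]] /=.
- by move=> _; rewrite inE => /eqP -> /=; rewrite map_f ?mem_enum.
- rewrite andbT => /eqP <- ya; have {ya} -> : y = (1, (qs a, [:: a])).
    by case: a ya => i; rewrite inE => /eqP.
  by rewrite [X in _ || (X || _)](map_f (fun g : qA Q => (qs g, [:: g]))) ?mem_enum ?orbT.
- case: a b => i [j|j] //= /and3P[/eqP ei /eqP ej _]; rewrite inE => /eqP -> /=.
    move: ej => /ordS_inj ->; rewrite ei.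
    by rewrite [X in _ || (_ || X)](map_f (fun v : 'I_m => (v, [:: inl v; inr v]))) ?mem_enum ?orbT.
  by rewrite [X in _ || (_ || X)](map_f (fun v : 'I_m => (v, [:: inl v; inr v]))) ?mem_enum ?orbT.
- by case: a => ?; case: b.
Qed.

Lemma brauer_nf_valid f : kq_valid f -> kq_valid (brauer_nf f).
Proof.
by move=> vf; apply/allP => x xf; apply/brauer_basis_valid/(brauer_nf_basis vf xf).
Qed.

End BrauerNormalForm.

(** * Vertices and arrows in an algebra with quadratic relations *)

Section Powers.
Variables (K : fieldType) (Q : quiver).
Implicit Types (f g : kq K Q).

Definition kq_pow f k : kq K Q := iter k (fun g => kq_mul g f) (kq_one K Q).

Lemma kq_pow_valid f k : kq_valid f -> kq_valid (kq_pow f k).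
Proof.
by move=> vf; elim: k => [|k IH] /=; [apply: kq_valid_one | apply: kq_valid_mul].
Qed.

Lemma kq_pow_long f k : kq_long 1 f -> kq_long k (kq_pow f k).
Proof.
move=> lf; elim: k => [|k IH] /=; first exact: kq_long0.
by rewrite -addn1; apply: kq_long_mul.
Qed.

Lemma alg_hom_pow (B : algType K) (phi : kq K Q -> B) f k :
  alg_hom phi -> kq_valid f -> phi (kq_pow f k) = phi f ^+ k.
Proof.
move=> [_ _ _ hM [_ h1]] vf; elim: k => [|k IH]; first by rewrite expr0.
by rewrite /= hM // ?kq_pow_valid // IH exprSr.
Qed.

(* The projection of K Q onto the simple quotient at v. *)
Definition kq_aug (v : qV Q) : kq K Q -> K^o :=
  kq_ext (path_val (fun w => (w == v)%:R : K^o) (fun _ : qA Q => 0)).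

Lemma kq_aug_hom v : alg_hom (kq_aug v).
Proof.
apply: path_val_hom => [u w||a]; rewrite ?mulr0 ?mul0r //.
  case: (altP (u =P v)) => [->|_]; last by rewrite mul0r; case: ifP.
  by rewrite mul1r eq_sym; case: eqP.
by rewrite (bigD1 v) //= eqxx big1 ?addr0 // => w /negbTE ->.
Qed.

Lemma kq_aug_long v f : kq_long 1 f -> kq_aug v f = 0.
Proof.
move=> /allP lf; rewrite /kq_aug /kq_ext big_seq big1 // => -[c [w s]] /lf /=.
case: s => //= a s _.
by rewrite /path_val /= big_cons mul0r mulr0 scaler0.
Qed.

Lemma kq_aug_vertex v w : kq_aug v (kq_path K (w, [::])) = (w == v)%:R.
Proof. by rewrite /kq_aug kq_ext_path /path_val /= big_nil mulr1. Qed.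

End Powers.

(** The multiplication table of a path algebra modulo all paths of length two, with the dual basis
    [d]. [rszb_dual] gives independence and [rszb_exp] gives spanning. *)
Record rad_sq_zero_basis (K : fieldType) (Q : quiver) (A : falgType K)
    (b : qV Q + qA Q -> A) (d : qV Q + qA Q -> 'Hom(A, K^o)) : Prop := {
  rszb_one : \sum_v b (inl v) = 1;
  rszb_ee : forall v w, b (inl v) * b (inl w) = if v == w then b (inl v) else 0;
  rszb_ea : forall v x, b (inl v) * b (inr x) = if v == qs x then b (inr x) else 0;
  rszb_ae : forall v x, b (inr x) * b (inl v) = if qt x == v then b (inr x) else 0;
  rszb_aa : forall x y, b (inr x) * b (inr y) = 0;
  rszb_dual : forall t u, d t (b u) = (t == u)%:R;
  rszb_exp : forall x, x = \sum_t d t x *: b t }.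

(** * Independence and spanning of the vertices and arrows *)

Section QuadraticPresentation.
Variables (K : fieldType) (Q : quiver) (gens : seq (kq K Q)) (A : falgType K).
Variable phi : kq K Q -> A.
Hypotheses (gens_long : {in gens, forall g, kq_long 2 g}) (phi_hom : alg_hom phi)
  (phi_surj : forall b, exists f, kq_valid f /\ phi f = b)
  (phi_ker : forall f, kq_valid f -> (phi f = 0 <-> in_ideal gens f)).
Local Notation T := (qV Q + qA Q)%type.

Definition short_path (t : T) : qpath Q :=
  match t with inl v => (v, [::]) | inr x => (qs x, [:: x]) end.

Lemma short_path_inj : injective short_path.
Proof. by case=> [v|x] [w|y] // [] => [->|_ ->]. Qed.

Lemma short_path_valid t : is_path (short_path t).
Proof. by case: t => x; rewrite /is_path /= ?eqxx. Qed.

Definition short_val (t : T) : A := phi (kq_path K (short_path t)).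

Definition short_comb (c : T -> K) : kq K Q := [seq (c t, short_path t) | t <- enum {: T}].

Lemma short_comb_valid c : kq_valid (short_comb c).
Proof. by apply/allP => x /mapP[t _ ->]; apply: short_path_valid. Qed.

Lemma short_comb_coef c t : kq_coef (short_comb c) (short_path t) = c t.
Proof.
rewrite /kq_coef big_map big_enum_cond /= (bigD1 t) ?eqxx //= big1 ?addr0 // => u /andP[/eqP].
by move=> /short_path_inj ->; rewrite eqxx.
Qed.

Lemma short_comb_val c : phi (short_comb c) = \sum_t c t *: short_val t.
Proof.
by rewrite (alg_hom_ext phi_hom (short_comb_valid c)) /kq_ext big_map big_enum.
Qed.

(** Two lifts of one element of [A] differ by an element of the ideal, which has no terms of length
    below 2. So coefficients at vertices and arrows are well defined on [A]. *)
Lemma short_coef_eq f g t : kq_valid f -> kq_valid g -> phi f = phi g ->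
  kq_coef f (short_path t) = kq_coef g (short_path t).
Proof.
move=> vf vg e; have [_ hD hZ _ _] := phi_hom.
have : phi (f ++ kq_scale (-1) g) = 0.
  by rewrite hD ?hZ ?kq_valid_scale // e scaleN1r subrr.
move/phi_ker; rewrite kq_valid_cat vf kq_valid_scale vg => /(_ isT).
move/(in_ideal_short (p := short_path t) gens_long).
rewrite kq_coef_cat kq_coef_scale mulN1r => E.
by apply/eqP; rewrite -subr_eq0 E //; case: (t).
Qed.

Lemma short_val_ee v w :
  short_val (inl v) * short_val (inl w) = if v == w then short_val (inl v) else 0.
Proof. by rewrite /short_val alg_hom_mul_path //= /pend /=; case: eqP => // ->. Qed.

Lemma short_val_ea v x :
  short_val (inl v) * short_val (inr x) = if v == qs x then short_val (inr x) else 0.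
Proof.
rewrite /short_val alg_hom_mul_path ?short_path_valid //= /pend /=.
by case: eqP => // ->.
Qed.

Lemma short_val_ae v x :
  short_val (inr x) * short_val (inl v) = if qt x == v then short_val (inr x) else 0.
Proof. by rewrite /short_val alg_hom_mul_path ?short_path_valid. Qed.

Lemma short_val_aa x y : short_val (inr x) * short_val (inr y) =
  if qt x == qs y then phi (kq_path K (qs x, [:: x; y])) else 0.
Proof. by rewrite /short_val alg_hom_mul_path ?short_path_valid. Qed.

Let n := #|{: T}|.
Let X : n.-tuple A := [tuple short_val (enum_val i) | i < n].

Let sumX (c : 'I_n -> K) : \sum_(i < n) c i *: X`_i = \sum_t c (enum_rank t) *: short_val t.
Proof.
rewrite (reindex (@enum_rank _)); last by exists enum_val => i _; rewrite ?enum_rankK ?enum_valK.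
by apply: eq_bigr => t _; rewrite -tnth_nth tnth_mktuple enum_rankK.
Qed.

Let freeX : free X.
Proof.
apply/freeP => c; rewrite sumX => E i.
pose c' t := c (enum_rank t).
rewrite -[i]enum_valK -/(c' _) -(short_comb_coef c') .
have e0 : phi [::] = 0 by have [_ _ _ _ []] := phi_hom.
rewrite (@short_coef_eq _ [::]) ?short_comb_valid ?short_comb_val ?e0 //.
by rewrite /kq_coef big_nil.
Qed.

(** The images of vertices and arrows are independent, so the dimension bound makes them a basis;
    [d] consists of its coordinate functions. *)
Lemma dim_rad_sq_zero_basis : (dim A <= #|qV Q| + #|qA Q|)%N ->
  exists d, rad_sq_zero_basis short_val d.
Proof.
rewrite -card_sum -/n => dimA.
have basX : basis_of fullv X by rewrite basisEfree freeX subvf dimvf size_tuple.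
pose d t : 'Hom(A, K^o) := linfun (coord X (enum_rank t) : A -> K^o).
have dE t x : d t x = coord X (enum_rank t) x by rewrite lfunE.
have expX x : x = \sum_t d t x *: short_val t.
  rewrite {1}(coord_basis basX (memvf x)) sumX; apply: eq_bigr => t _.
  by rewrite dE.
exists d; split=> //.
- exact: alg_hom_one.
- exact: short_val_ee.
- exact: short_val_ea.
- exact: short_val_ae.
- move=> x y; rewrite short_val_aa; case: eqP => // xy.
  have vp : kq_valid (kq_path K ((qs x, [:: x; y]) : qpath Q)).
    by rewrite kq_valid_path /is_path /= eqxx xy eqxx.
  (* The coordinates of [z] are coefficients at short paths and may be read on either of two lifts:
     its expansion [short_comb], or the path [[:: x; y]], where they are zero because it has length
     2. *)
  set z := phi _; rewrite (expX z) big1 // => t _.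
  rewrite -(short_comb_coef (fun t => d t z) t).
  rewrite -(@short_coef_eq (kq_path K (qs x, [:: x; y]))) ?short_comb_valid //.
    by rewrite kq_coef_notin ?scale0r //; case: (t) => ?; rewrite inE; apply/eqP => -[].
  by rewrite short_comb_val -expX.
- move=> t u; rewrite dE.
  have -> : short_val u = X`_(enum_rank u) by rewrite -tnth_nth tnth_mktuple enum_rankK.
  by rewrite coord_free // (inj_eq enum_rank_inj) eq_sym.
Qed.

(** A path with at least two arrows factors through the product of its first two, hence maps to
    zero; vertices and arrows therefore span. *)
Lemma dim_of_aa0 : (forall x y, short_val (inr x) * short_val (inr y) = 0) ->
  (dim A <= #|qV Q| + #|qA Q|)%N.
Proof.
move=> aa; rewrite -card_sum -/n -dimvf.
suff : (fullv <= <<X>>)%VS.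
  by move=> /dimvS /leq_trans; apply; rewrite (leq_trans (dim_span _)) ?size_tuple.
apply/subvP => x _; have [f [vf <-]] := phi_surj x.
rewrite (alg_hom_ext phi_hom vf) /kq_ext big_seq; apply: memv_suml => y yf; apply: memvZ.
have /= := allP vf _ yf; case: (y.2) => v [|a [|a' s]] vp.
- apply: memv_span; apply/mapP; exists (enum_rank (inl v : T)); rewrite ?mem_enum //.
  by rewrite /= enum_rankK.
- apply: memv_span; apply/mapP; exists (enum_rank (inr a : T)); rewrite ?mem_enum //.
  by move: vp; rewrite /is_path /= enum_rankK andbT => /eqP <-.
move: vp; rewrite /is_path /= => /and3P[/eqP av /eqP a'a cs].
have := alg_hom_mul_path (p := (qs a, [:: a; a'])) (q := (qt a', s)) phi_hom _ _.
rewrite /= /pend /= /pstart /= eqxx av => <-; rewrite /is_path ?av //=; last 1 first.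
- by rewrite av eqxx a'a eqxx.
by have := aa a a'; rewrite short_val_aa a'a eqxx av => ->; rewrite mul0r mem0v.
Qed.

End QuadraticPresentation.

(** * Characters and radical of an algebra with such a basis *)

Section RadSqZeroBasis.
Variables (K : fieldType) (Q : quiver) (A : falgType K).
Variables (b : qV Q + qA Q -> A) (d : qV Q + qA Q -> 'Hom(A, K^o)).
Hypothesis bd : rad_sq_zero_basis b d.

Lemma rszb_lin (f : 'Hom(A, K^o)) y : f y = \sum_t d t y * f (b t).
Proof.
rewrite {1}(rszb_exp bd y) linear_sum; apply: eq_bigr => t _.
by rewrite linearZ.
Qed.

Lemma rszb_mulr_arrow y x : y * b (inr x) = d (inl (qs x)) y *: b (inr x).
Proof.
rewrite {1}(rszb_exp bd y) mulr_suml big_sumType /= (bigD1 (qs x)) //=.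
rewrite -scalerAl (rszb_ea bd) eqxx !big1 ?addr0 // => [a _|v /negbTE vx].
  by rewrite -scalerAl (rszb_aa bd) scaler0.
by rewrite -scalerAl (rszb_ea bd) vx scaler0.
Qed.

Lemma rszb_mull_arrow y x : b (inr x) * y = d (inl (qt x)) y *: b (inr x).
Proof.
rewrite {1}(rszb_exp bd y) mulr_sumr big_sumType /= (bigD1 (qt x)) //=.
rewrite -scalerAr (rszb_ae bd) eqxx !big1 ?addr0 // => [a _|v /negbTE vx].
  by rewrite -scalerAr (rszb_aa bd) scaler0.
by rewrite -scalerAr (rszb_ae bd) eq_sym vx scaler0.
Qed.

Lemma rszb_mulr_vertex t y w : d t (y * b (inl w)) =
  if match t with inl v => v | inr x => qt x end == w then d t y else 0.
Proof.
have E u : b u * b (inl w) =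
  if match u with inl v => v | inr x => qt x end == w then b u else 0.
  by case: u => u; rewrite ?(rszb_ee bd) ?(rszb_ae bd).
rewrite {1}(rszb_exp bd y) mulr_suml linear_sum (bigD1 t) //= big1 ?addr0.
  rewrite -scalerAl E linearZ /=; case: ifP => _;
  last by rewrite linear0 scaler0.
  by rewrite (rszb_dual bd) eqxx [_ *: _]mulr1.
move=> u /negbTE ut; rewrite -scalerAl E linearZ /=; case: ifP => _;
  last by rewrite linear0 scaler0.
by rewrite (rszb_dual bd) eq_sym ut scaler0.
Qed.

Lemma rszb_mull_vertex t y w : d t (b (inl w) * y) =
  if w == match t with inl v => v | inr x => qs x end then d t y else 0.
Proof.
have E u : b (inl w) * b u =
  if w == match u with inl v => v | inr x => qs x end then b u else 0.
  by case: u => u; rewrite ?(rszb_ee bd) ?(rszb_ea bd) //; case: eqP => // ->.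
rewrite {1}(rszb_exp bd y) mulr_sumr linear_sum (bigD1 t) //= big1 ?addr0.
  rewrite -scalerAr E linearZ /=; case: ifP => _;
  last by rewrite linear0 scaler0.
  by rewrite (rszb_dual bd) eqxx [_ *: _]mulr1.
move=> u /negbTE ut; rewrite -scalerAr E linearZ /=; case: ifP => _;
  last by rewrite linear0 scaler0.
by rewrite (rszb_dual bd) eq_sym ut scaler0.
Qed.

(** The coordinate at a vertex is a character of [A]: multiplying by an arrow yields only a multiple
    of that arrow, on which the coordinate vanishes. *)
Lemma rszb_vertex_mul v y z : d (inl v) (y * z) = d (inl v) y * d (inl v) z.
Proof.
rewrite {1}(rszb_exp bd z) mulr_sumr linear_sum big_sumType /= (bigD1 v) //= !big1.
- by rewrite !addr0 -scalerAr linearZ /= rszb_mulr_vertex eqxx mulrC.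
- by move=> x _; rewrite -scalerAr rszb_mulr_arrow !linearZ /= (rszb_dual bd) !scaler0.
- move=> w /negbTE vw; rewrite -scalerAr linearZ /= rszb_mulr_vertex.
  by rewrite eq_sym vw scaler0.
Qed.

Lemma rszb_maximal v : maximal_left_ideal (lker (d (inl v))).
Proof.
have dv : d (inl v) (b (inl v)) = 1 by rewrite (rszb_dual bd) eqxx.
split.
- by move=> a x; rewrite !memv_ker rszb_vertex_mul => /eqP ->; rewrite mulr0.
- apply/negP => /eqP /vspaceP /(_ (b (inl v))).
  by rewrite memvf memv_ker dv oner_eq0.
move=> W idW kW; have [le|] := boolP (W <= lker (d (inl v)))%VS.
  by left; apply: subv_anti; rewrite le kW.
case/subvPn => w wW; rewrite memv_ker => dw; right.
apply/vspaceP => x; rewrite memvf.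
(* Subtracting the multiple of [w] with the same value under the character moves [x] into the
   kernel, which has codimension one. *)
rewrite -(subrK ((d (inl v) x / d (inl v) w) *: w) x) memvD ?memvZ //.
apply: (subvP kW); rewrite memv_ker linearB linearZ /= [_ *: _]divfK //.
by rewrite subrr.
Qed.

(** A radical element lies in the kernel of every vertex character, so it is a combination of
    arrows, and products of arrows vanish. *)
Lemma rszb_rad_sq_zero : rad_sq_zero A.
Proof.
have radE x : in_rad x -> x = \sum_a d (inr a) x *: b (inr a).
  move=> rx; rewrite {1}(rszb_exp bd x) big_sumType /= big1 ?add0r // => v _.
  by have := rx _ (rszb_maximal v); rewrite memv_ker => /eqP ->; rewrite scale0r.
move=> x y /radE -> /radE ->; rewrite mulr_suml big1 // => a _.
rewrite mulr_sumr big1 // => c _.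
by rewrite -scalerAl -scalerAr (rszb_aa bd) !scaler0.
Qed.

End RadSqZeroBasis.

(** * Nilpotency of the arrow ideal and the radical *)

Section Admissible.
Variables (K : fieldType) (Q : quiver) (A : falgType K) (phi : kq K Q -> A) (N : nat).
Hypotheses (phi_hom : alg_hom phi)
  (phi_surj : forall b, exists f, kq_valid f /\ phi f = b)
  (phi_nil : forall p, is_path p -> (N <= size p.2)%N -> phi (kq_path K p) = 0).

Lemma long_nilpotent f : kq_valid f -> kq_long 1 f -> phi f ^+ N = 0.
Proof.
move=> vf lf; rewrite -(alg_hom_pow N phi_hom vf).
have vN := kq_pow_valid N vf; have /allP lN := kq_pow_long N lf.
rewrite (alg_hom_ext phi_hom vN) /kq_ext big_seq big1 // => x xf.
by rewrite phi_nil ?scaler0 ?lN ?(allP vN).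
Qed.

(** If the arrow [a] were outside a maximal left ideal [L], then [1 = l + r * a] with [l] in [L].
    Since [r * a] comes from the arrow ideal, it is nilpotent, so [l] is invertible and [L] is
    everything. *)
Lemma arrow_in_rad x : in_rad (phi (kq_path K (qs x, [:: x]))).
Proof.
set a := phi _ => L [idL Lproper Lmax]; apply/negPn/negP => aL.
pose W := (L + (amulr a @: fullv))%VS.
have idW : left_ideal W.
  move=> c _ /memv_addP[l lL [_ /memv_imgP[r _ ->] ->]].
  rewrite mulrDr memv_add ?idL // lfunE /= mulrA.
  by apply/memv_imgP; exists (c * r); rewrite ?memvf // lfunE.
case: (Lmax W idW (addvSl _ _)) => EW.
  case/negP: aL; rewrite -EW -[a]add0r memv_add ?mem0v //.
  by apply/memv_imgP; exists 1; rewrite ?memvf // lfunE /= mul1r.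
have := memvf (1 : A); rewrite -EW => /memv_addP[l lL [_ /memv_imgP[r _ ->]]].
rewrite lfunE /= => E1.
have [f [vf fr]] := phi_surj r.
have va : kq_valid (kq_path K ((qs x, [:: x]) : qpath Q)).
  by rewrite kq_valid_path /is_path /= eqxx.
have nil : (r * a) ^+ N = 0.
  have [_ _ _ hM _] := phi_hom.
  rewrite -fr -hM //; apply: long_nilpotent; first exact: kq_valid_mul.
  by rewrite -[1%N]add0n; apply: kq_long_mul; first exact: kq_long0.
case/eqP: Lproper; apply/vspaceP => y; rewrite memvf -[y]mulr1; apply: (idL y).
(* The finite geometric sum [S] is the inverse of [1 - z]. *)
set z := r * a in E1 nil; pose S := \sum_(i < N) z ^+ i.
have lE : l = 1 - z by rewrite E1 addrK.
have comm_z : GRing.comm (z - 1) S.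
  apply: commr_sum => i _; apply/commrX/commr_sym/commrB; first exact: commr_refl.
  exact: commr1.
have -> : 1 = S * l.
  by rewrite lE -opprB mulrN -comm_z -subrX1 nil sub0r opprK.
exact: (idL S).
Qed.

End Admissible.

(** * Comparison of the numbers of vertices *)

Section VertexCount.
Variables (K : fieldType) (Q : quiver) (A : falgType K) (phi : kq K Q -> A) (N : nat).
Hypotheses (phi_hom : alg_hom phi)
  (phi_surj : forall b, exists f, kq_valid f /\ phi f = b)
  (phi_nil : forall p, is_path p -> (N <= size p.2)%N -> phi (kq_path K p) = 0).
Variables (Q' : quiver) (gens' : seq (kq K Q')) (psi : kq K Q' -> triv_ext A).
Hypotheses (gens'_valid : {in gens', forall g, kq_valid g})
  (gens'_long : {in gens', forall g, kq_long 1 g})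
  (psi_hom : alg_hom psi)
  (psi_surj : forall b, exists f, kq_valid f /\ psi f = b)
  (psi_ker : forall f, kq_valid f -> psi f = 0 -> in_ideal gens' f).

Lemma vertex_arrow_split f : kq_valid f -> exists c g,
  [/\ kq_valid g, kq_long 1 g & phi f = \sum_v c v *: phi (kq_path K (v, [::])) + phi g].
Proof.
have [_ hD hZ _ [h0 _]] := phi_hom.
elim: f => [|[a [w s]] f IH] => [_|/andP[/= vx vf]].
  exists (fun=> 0), [::]; split; rewrite // h0 addr0 big1 // => v _.
  by rewrite scale0r.
have [c [g [vg lg E]]] := IH vf.
have vp : kq_valid (kq_path K (w, s)) by rewrite kq_valid_path.
have -> : phi ((a, (w, s)) :: f) = a *: phi (kq_path K (w, s)) + phi f.
  by rewrite -hZ // -hD ?kq_valid_scale //= mulr1.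
case: s vx vp => [|x s] vx vp; last first.
  exists c, (kq_scale a (kq_path K (w, x :: s)) ++ g); split=> //.
    by rewrite kq_valid_cat kq_valid_scale vp.
  by rewrite hD ?kq_valid_scale // hZ // E addrCA.
exists (fun v => (if v == w then a else 0) + c v), g; split=> //.
under eq_bigr do rewrite scalerDl.
rewrite big_split /= (bigD1 w) //= eqxx big1 ?addr0 => [|v /negbTE ->].
  by rewrite E addrA.
by rewrite scale0r.
Qed.

(** The relations lie in the arrow ideal, which [kq_aug v] kills; so [kq_aug v] descends to a
    character of the trivial extension. *)
Lemma kq_aug_eq v f g : kq_valid f -> kq_valid g -> psi f = psi g ->
  kq_aug v f = kq_aug v g.
Proof.
move=> vf vg e; have [_ hD hZ _ _] := psi_hom.
have vfg : kq_valid (f ++ kq_scale (-1) g) by rewrite kq_valid_cat vf kq_valid_scale.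
have : psi (f ++ kq_scale (-1) g) = 0.
  by rewrite hD ?hZ ?kq_valid_scale // e scaleN1r subrr.
move/(psi_ker vfg)/(alg_hom_ideal (kq_aug_hom K v)) => E.
have : kq_aug v (f ++ kq_scale (-1) g) = 0.
  by apply: E => h hh; rewrite gens'_valid // kq_aug_long ?gens'_long.
rewrite /kq_aug kq_ext_cat kq_ext_scale scaleN1r => /eqP.
by rewrite subr_eq0 => /eqP.
Qed.

Lemma kq_aug_nilpotent v f k : kq_valid f -> psi f ^+ k = 0 -> kq_aug v f = 0.
Proof.
move=> vf; rewrite -(alg_hom_pow k psi_hom vf) => E.
have psi0 : psi [::] = 0 by have [_ _ _ _ []] := psi_hom.
have : kq_aug v (kq_pow f k) = kq_aug v [::].
  by apply: kq_aug_eq; rewrite ?kq_pow_valid // psi0.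
rewrite (alg_hom_pow k (kq_aug_hom K v) vf) {2}/kq_aug /kq_ext big_nil => /eqP.
by rewrite (@expf_eq0 K) => /andP[_ /eqP].
Qed.

(** The power [u ^+ k] lies in the summand [DA], whose square is zero. *)
Lemma triv_ext_nilpotent (u : triv_ext A) k : u.1 ^+ k = 0 -> u ^+ (k + k) = 0.
Proof.
move=> uk.
have E l : (u ^+ l).1 = u.1 ^+ l.
  by elim: l => [|l IH] //; rewrite !exprS triv_ext_mul1E IH.
rewrite exprD; apply: triv_ext_eq => [|x].
  by rewrite triv_ext_mul1E !E uk mul0r.
by rewrite triv_ext_mul2E !E uk mulr0 mul0r !linear0 addr0 lfunE.
Qed.

(** Modulo nilpotent elements the trivial extension is spanned by the vertex idempotents of [A]. The
    vertices of [Q'] are separated by characters that kill nilpotents, so there are at most as many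
    of them. *)
Lemma card_vertices_le : (#|qV Q'| <= #|qV Q|)%N.
Proof.
pose e v := phi (kq_path K (v, [::])).
have /fin_all_exists[F HF] v : exists f, kq_valid f /\ psi f = (e v, 0) := psi_surj _.
have key w : exists c : qV Q -> K, forall v, \sum_i c i * kq_aug v (F i) = (w == v)%:R :> K.
  have [h [vh hE]] := phi_surj (psi (kq_path K (w, [::]))).1.
  have [c [g [vg lg E]]] := vertex_arrow_split vh; exists c => v.
  (* [u] collects the arrow part in [A] and the whole component in [DA]; it is nilpotent and
     invisible to the characters. *)
  pose u : triv_ext A := (phi g, (psi (kq_path K (w, [::]))).2).
  have [r [vr rE]] := psi_surj u.
  have augr : kq_aug v r = 0.
    apply: (@kq_aug_nilpotent v r (N + N)) => //; rewrite rE; apply: triv_ext_nilpotent.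
    exact: (long_nilpotent phi_hom phi_nil).
  (* This lifts to [K Q'] the combination of vertex idempotents that is left once [u] is removed. *)
  pose s := [seq kq_scale (c i) (F i) | i <- enum (qV Q)].
  have vs : all (@kq_valid K Q') s.
    by apply/allP => f /mapP[i _ ->]; rewrite kq_valid_scale; case: (HF i).
  have vfs : kq_valid (flatten s) by apply/allP => x /flattenP[f /(allP vs)/allP]; apply.
  have [_ hD hZ _ _] := psi_hom.
  have [_ aD aZ _ _] := kq_aug_hom K v.
  rewrite -kq_aug_vertex (@kq_aug_eq _ _ (flatten s ++ r)) ?kq_valid_cat ?vfs //.
    rewrite aD // augr addr0 (alg_hom_flatten (kq_aug_hom K v) vs) big_map big_enum.
    by apply: eq_bigr => i _; rewrite aZ //; case: (HF i).
  rewrite hD // rE (alg_hom_flatten psi_hom vs) big_map big_enum /=.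
  have -> : \sum_i psi (kq_scale (c i) (F i)) = (\sum_i c i *: e i, 0) :> triv_ext A.
    transitivity (\sum_i (c i *: e i, 0) : triv_ext A).
      apply: eq_bigr => i _; have [vi Ei] := HF i; rewrite hZ // Ei.
      by apply: triv_ext_eq => //= x; rewrite scaler0.
    apply: (big_rec2 (fun (x : triv_ext A) (y : A) => x = (y, 0))) => // i y1 y2 _ ->.
    by apply: triv_ext_eq => //= x; rewrite add0r.
  rewrite [LHS]surjective_pairing -hE E.
  by apply: triv_ext_eq => //= x; rewrite add0r.
have /fin_all_exists[C HC] := key.
pose n := #|qV Q|; pose m := #|qV Q'|.
pose Cm : 'M[K]_(m, n) := \matrix_(i, j) C (enum_val i) (enum_val j).
pose Mm : 'M[K]_(n, m) := \matrix_(i, j) kq_aug (enum_val j) (F (enum_val i)).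
(* By [HC] the product of [Cm] and [Mm] is the identity of size [m] factored through size [n]. *)
apply: (@mulmx1_min _ m n Cm Mm); apply/matrixP => i j; rewrite !mxE.
rewrite -(inj_eq enum_val_inj) -HC; under eq_bigr do rewrite !mxE.
rewrite [RHS](reindex (@enum_val _ (mem (qV Q)))) //.
by exists enum_rank => k _; rewrite ?enum_rankK ?enum_valK.
Qed.

End VertexCount.

(** * The trivial extension of a radical square zero cycle *)

Section CycleTrivialExtension.
Variables (K : fieldType) (n : nat) (o : 'I_n -> bool) (A : falgType K).
Local Notation Q := (cycle_quiver o).
Local Notation BQ := (brauer_quiver n).
Variables (b : qV Q + qA Q -> A) (d : qV Q + qA Q -> 'Hom(A, K^o)).
Hypothesis bd : rad_sq_zero_basis b d.
Implicit Types (i j v w : 'I_n).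

(** [E] and [U] are the basis of [A], [S] and [V] the dual basis of [DA]. The element [V i] runs
    against the arrow [i], from its target to its source. *)
Let E v : triv_ext A := (b (inl v), 0).
Let U i : triv_ext A := (b (inr i), 0).
Let V i : triv_ext A := (0, d (inr i)).
Let S v : triv_ext A := (0, d (inl v)).

(* The arrow i of the cycle becomes alpha_i or beta_i according to its
   orientation, and the opposite arrow goes to the dual basis vector of i. *)
Definition cycle_arrow (g : qA BQ) : triv_ext A :=
  match g with
  | inl i => if o i then U i else V i
  | inr i => if o i then V i else U i
  end.
Local Notation W := cycle_arrow.
Local Notation pval := (path_val (Q := BQ) (B := triv_ext A) E W).

Definition cycle_map : kq K BQ -> triv_ext A := kq_ext pval.

Let EE v w : E v * E w = if v == w then E v else 0.
Proof.
apply: triv_ext_eq => [|x]; first by rewrite triv_ext_mul1E (rszb_ee bd); case: eqP.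
by rewrite triv_ext_mul2E !lfunE addr0; case: eqP; rewrite /= lfunE.
Qed.

Let E1 : \sum_v E v = 1.
Proof.
transitivity ((\sum_v b (inl v), 0) : triv_ext A); last by rewrite (rszb_one bd).
apply: (big_rec2 (fun (x : triv_ext A) (y : A) => x = (y, 0))) => // i y1 y2 _ ->.
by apply: triv_ext_eq => //= x; rewrite add0r.
Qed.

Let UE i v : U i * E v = if @qt Q i == v then U i else 0.
Proof.
apply: triv_ext_eq => [|x]; first by rewrite triv_ext_mul1E (rszb_ae bd); case: eqP.
by rewrite triv_ext_mul2E !lfunE addr0; case: eqP; rewrite /= lfunE.
Qed.

Let EU i v : E v * U i = if v == @qs Q i then U i else 0.
Proof.
apply: triv_ext_eq => [|x]; first by rewrite triv_ext_mul1E (rszb_ea bd); case: eqP.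
by rewrite triv_ext_mul2E !lfunE addr0; case: eqP; rewrite /= lfunE.
Qed.

Let VE i v : V i * E v = if v == @qs Q i then V i else 0.
Proof.
apply: triv_ext_eq => [|x]; first by rewrite triv_ext_mul1E mul0r; case: eqP.
rewrite triv_ext_mul2E lfunE add0r (rszb_mull_vertex bd).
by case: eqP; rewrite //= lfunE.
Qed.

Let EV i v : E v * V i = if @qt Q i == v then V i else 0.
Proof.
apply: triv_ext_eq => [|x]; first by rewrite triv_ext_mul1E mulr0; case: eqP.
rewrite triv_ext_mul2E lfunE addr0 (rszb_mulr_vertex bd).
by case: eqP; rewrite //= lfunE.
Qed.

Let ES v : E v * S v = S v.
Proof.
apply: triv_ext_eq => [|x]; first by rewrite triv_ext_mul1E mulr0.
by rewrite triv_ext_mul2E lfunE addr0 (rszb_mulr_vertex bd) eqxx.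
Qed.

Let UU i j : U i * U j = 0.
Proof.
apply: triv_ext_eq => [|x]; first by rewrite triv_ext_mul1E (rszb_aa bd).
by rewrite triv_ext_mul2E !lfunE addr0.
Qed.

Let VV i j : V i * V j = 0.
Proof.
apply: triv_ext_eq => [|x]; first by rewrite triv_ext_mul1E mulr0.
by rewrite triv_ext_mul2E mulr0 mul0r !linear0 lfunE addr0.
Qed.

(** Right multiplication by the arrow [i] sees only the coordinate at its source, so composing it
    with the dual vector of that arrow gives the dual vector of the source. *)
Let UV i j : U i * V j = if i == j then S (@qs Q i) else 0.
Proof.
apply: triv_ext_eq => [|x]; first by rewrite triv_ext_mul1E mulr0; case: eqP.
rewrite triv_ext_mul2E lfunE addr0 (rszb_mulr_arrow bd) linearZ /= (rszb_dual bd).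
rewrite (inj_eq inr_inj) eq_sym; case: eqP => _; last by rewrite scaler0 lfunE.
exact: mulr1.
Qed.

Let VU i j : V i * U j = if i == j then S (@qt Q i) else 0.
Proof.
apply: triv_ext_eq => [|x]; first by rewrite triv_ext_mul1E mul0r; case: eqP.
rewrite triv_ext_mul2E lfunE add0r (rszb_mull_arrow bd) linearZ /= (rszb_dual bd).
rewrite (inj_eq inr_inj); case: eqP => [->|_]; last by rewrite scaler0 lfunE.
exact: mulr1.
Qed.

Let WE g : W g * E (@qt BQ g) = W g.
Proof.
by case: g => i /=; case oi: (o i); rewrite ?UE ?VE /= ?oi eqxx.
Qed.

Let EW g : E (@qs BQ g) * W g = W g.
Proof.
by case: g => i /=; case oi: (o i); rewrite ?EU ?EV /= ?oi eqxx.
Qed.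

Let WWlr i : W (inl i) * W (inr i) = S i.
Proof. by rewrite /=; case oi: (o i); rewrite ?UV ?VU eqxx /= oi. Qed.

Let WWrl i : W (inr i) * W (inl i) = S (ordS i).
Proof. by rewrite /=; case oi: (o i); rewrite ?UV ?VU eqxx /= oi. Qed.

Let WWll i j : W (inl i) * W (inl j) = 0.
Proof.
(* The only possibly nonzero products combine a [U] and a [V] of equal index; but here equal indices
   have the same orientation and hence the same type. *)
rewrite /=; case oi: (o i); case oj: (o j); rewrite ?UU ?VV // ?UV ?VU;
  by case: eqP => // ij; rewrite ij oj in oi.
Qed.

Let WWrr i j : W (inr i) * W (inr j) = 0.
Proof.
rewrite /=; case oi: (o i); case oj: (o j); rewrite ?UU ?VV // ?UV ?VU;
  by case: eqP => // ij; rewrite ij oj in oi.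
Qed.

Lemma cycle_map_hom : alg_hom cycle_map.
Proof. exact: path_val_hom. Qed.

Lemma cycle_map_rels g : g \in brauer_rels K n -> cycle_map g = 0.
Proof.
case/brauer_relsP => i [] ->; rewrite /cycle_map.
- by rewrite kq_ext_path /path_val big_cons big_seq1 WWll mulr0.
- by rewrite kq_ext_path /path_val big_cons big_seq1 WWrr mulr0.
rewrite /kq_ext big_cons big_seq1 /path_val !big_cons !big_nil !mulr1.
by rewrite WWrl WWlr scale1r scaleN1r subrr.
Qed.

(** The path that [cycle_map] sends to the basis vector [b t] of [A] if [c] holds, and to the dual
    vector [d t] otherwise. *)
Definition cycle_path (c : bool) (t : qV Q + qA Q) : qpath BQ :=
  match c, t with
  | true, inl v => (v, [::])
  | false, inl v => (v, [:: inl v; inr v])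
  | _, inr i => let g : qA BQ := if o i == c then inl i else inr i in (qs g, [:: g])
  end.

Lemma cycle_path_valid c t : is_path (cycle_path c t).
Proof. by case: c t => -[i|i] //; rewrite /is_path /= ?eqxx. Qed.

Lemma cycle_path_val c t :
  pval (cycle_path c t) = if c then (b t, 0) else (0, d t).
Proof.
case: c t => -[i|i] /=; rewrite /path_val ?big_cons big_nil ?mulr1 //=.
- by case oi: (o i); rewrite /= [E _ * _](EW (inl i), EW (inr i)) /= oi.
- by rewrite WWlr ES.
- by case oi: (o i); rewrite /= [E _ * _](EW (inl i), EW (inr i)) /= oi.
Qed.

Lemma brauer_basis_cycle_path p : p \in brauer_basis n -> exists c t, p = cycle_path c t.
Proof.
rewrite !mem_cat => /or3P[] /mapP[x _ ->]; first by exists true, (inl x).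
  case: x => i; first by exists (o i), (inr i); rewrite /cycle_path; case: (o i).
  by exists (~~ o i), (inr i); rewrite /cycle_path; case: (o i).
by exists false, (inl x).
Qed.

(** On the summand [DA] the coordinate along [d t] is evaluation at [b t]. *)
Let coord c t (u : triv_ext A) : K := if c then d t u.1 else u.2 (b t).

Let coord_path c t c' t' :
  coord c t (pval (cycle_path c' t')) = ((c == c') && (t == t'))%:R.
Proof.
rewrite cycle_path_val /coord; case: c c' => -[] //=; rewrite ?linear0 ?lfunE //.
  exact: (rszb_dual bd).
by rewrite (rszb_dual bd) eq_sym.
Qed.

Let cycle_path_eq c t c' t' :
  (cycle_path c' t' == cycle_path c t) = (c == c') && (t == t').
Proof.
apply/idP/idP => [/eqP e|/andP[/eqP -> /eqP -> //]].
have := coord_path c t c' t'; rewrite e coord_path !eqxx andbT.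
by case: (_ && _) => // /eqP; rewrite oner_eq0.
Qed.

Lemma cycle_map_surj u : exists f, kq_valid f /\ cycle_map f = u.
Proof.
have [_ hD hZ _ [h0 _]] := cycle_map_hom.
pose f c (k : _ -> K) := [seq (k t, cycle_path c t) | t <- enum {: qV Q + qA Q}].
have vf c k : kq_valid (f c k).
  by apply/allP => x /mapP[t _ ->]; apply: cycle_path_valid.
exists (f true (fun t => d t u.1) ++ f false (fun t => u.2 (b t))).
rewrite kq_valid_cat !vf hD //; split=> //.
rewrite /cycle_map /kq_ext big_map big_enum big_map big_enum.
under eq_bigr do rewrite cycle_path_val.
under [X in _ + X]eq_bigr do rewrite cycle_path_val.
have -> : \sum_t d t u.1 *: (b t, 0) = (u.1, 0) :> triv_ext A.
  rewrite {2}(rszb_exp bd u.1).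
  apply: (big_rec2 (fun (x : triv_ext A) (y : A) => x = (y, 0))) => // i y1 y2 _ ->.
  by apply: triv_ext_eq => //= x; rewrite scaler0 add0r.
have -> : \sum_t u.2 (b t) *: (0, d t) = (0, u.2) :> triv_ext A.
  transitivity ((0, \sum_t u.2 (b t) *: d t) : triv_ext A).
    apply: (big_rec2 (fun (x : triv_ext A) (y : 'Hom(A, K^o)) => x = (0, y))) => // i y1 y2 _ ->.
    by apply: triv_ext_eq => //=; rewrite scaler0 add0r.
  apply: triv_ext_eq => //= x; rewrite sum_lfunE (rszb_lin bd u.2).
  by apply: eq_bigr => t _; rewrite lfunE /= [LHS]mulrC.
by apply: triv_ext_eq => [|x] /=; rewrite ?addr0 ?add0r.
Qed.

(** An element of the kernel has a normal form that is also in the kernel. The paths of the normal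
    form have independent images, so all its coefficients vanish and the element lies in the
    ideal. *)
Lemma cycle_map_ker f : kq_valid f -> cycle_map f = 0 <-> in_ideal (brauer_rels K n) f.
Proof.
move=> vf; split=> [f0|]; last first.
  apply: (alg_hom_ideal cycle_map_hom) => g gg.
  by split; [apply: brauer_rels_valid gg | apply: cycle_map_rels].
have [_ hD hZ _ _] := cycle_map_hom.
have Inf := brauer_nfP vf; have vn := brauer_nf_valid vf.
have nf0 : cycle_map (brauer_nf f) = 0.
  have : cycle_map (f ++ kq_scale (-1) (brauer_nf f)) = 0.
    apply: (alg_hom_ideal cycle_map_hom) Inf => g gg.
    by split; [apply: brauer_rels_valid gg | apply: cycle_map_rels].
  rewrite hD ?kq_valid_scale // hZ // f0 add0r scaleN1r => /eqP.
  by rewrite oppr_eq0 => /eqP.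
have coef0 p : kq_coef (brauer_nf f) p = 0.
  have [/mapP[x xf ->]|/kq_coef_notin //] := boolP (p \in [seq x.2 | x <- brauer_nf f]).
  have [c [t ->]] := brauer_basis_cycle_path (brauer_nf_basis vf xf).
  (* The coefficient of the normal form at a basis path equals the matching coordinate of its image,
     which is zero. *)
  transitivity (coord c t (cycle_map (brauer_nf f))); last first.
    by rewrite nf0 /coord; case: (c); rewrite ?linear0 ?lfunE.
  have coordD (u v : triv_ext A) : coord c t (u + v) = coord c t u + coord c t v.
    by rewrite /coord; case: (c); rewrite ?linearD ?lfunE.
  have coordZ k (u : triv_ext A) : coord c t (k *: u) = k * coord c t u.
    by rewrite /coord; case: (c) => /=; [rewrite linearZ | rewrite lfunE].
  have coord0 : coord c t 0 = 0 by rewrite /coord; case: (c); rewrite ?linear0 ?lfunE.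
  rewrite /cycle_map /kq_ext (big_morph (coord c t) coordD coord0).
  rewrite /kq_coef big_mkcond /= big_seq [RHS]big_seq; apply: eq_bigr => y yf.
  have [c' [t' e]] := brauer_basis_cycle_path (brauer_nf_basis vf yf).
  rewrite coordZ e coord_path cycle_path_eq.
  by case: (_ && _); rewrite ?mulr1 ?mulr0.
apply: in_ideal_coef Inf => // p.
by rewrite kq_coef_cat kq_coef_scale coef0 mulr0 addr0.
Qed.

End CycleTrivialExtension.

(** Normal forms span the trivial extension, so [2 * dim A] is at most the number [4 * m] of basis
    paths. *)
Lemma brauer_dim_le (K : fieldType) (m : nat) (A : falgType K)
    (psi : kq K (brauer_quiver m) -> triv_ext A) :
  alg_hom psi -> (forall b, exists f, kq_valid f /\ psi f = b) ->
  (forall f, in_ideal (brauer_rels K m) f -> psi f = 0) ->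
  (dim A <= 2 * m)%N.
Proof.
move=> psi_hom psi_surj psi_ker; have [_ hD hZ _ _] := psi_hom.
rewrite -(@leq_pmul2l 2) // mulnA -(size_brauer_basis m) mul2n -addnn -dim_triv_ext -dimvf.
pose X : seq (triv_ext A) := [seq psi (kq_path K p) | p <- brauer_basis m].
rewrite -(size_map (fun p => psi (kq_path K p))) -/X; apply: leq_trans (dim_span X).
apply/dimvS/subvP => x _; have [f [vf <-]] := psi_surj x.
have vn := brauer_nf_valid vf.
have : psi (f ++ kq_scale (-1) (brauer_nf f)) = 0 by apply/psi_ker/brauer_nfP.
rewrite hD ?kq_valid_scale // hZ // scaleN1r => /eqP; rewrite subr_eq0 => /eqP ->.
rewrite (alg_hom_ext psi_hom vn) /kq_ext big_seq; apply: memv_suml => y yf.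
by apply/memvZ/memv_span/map_f/(brauer_nf_basis vf).
Qed.

Theorem theorem3p10 (K : closedFieldType) (n : nat) (o : 'I_n -> bool)
    (rel : seq ('I_n * 'I_n)) (A : falgType K) :
  (0 < n)%N ->
  gentle K (Q := cycle_quiver o) rel ->
  presented_by (rel_gens K (Q := cycle_quiver o) rel) +%R *%R *:%R (0 : A) 1 ->
  is_brauer_cycle (@T_add K A) (@T_mul K A) (@T_scal K A) (T_zero A) (T_one A)
  <-> rad_sq_zero A.
Proof.
move=> n_gt0 [_ _ _ _ [N [_ adm]]] [phi [phi_hom phi_surj phi_ker]].
set Q := cycle_quiver o in adm phi phi_hom phi_surj phi_ker.
have phi_nil p : is_path p -> (N <= size p.2)%N -> phi (kq_path K p) = 0.
  by move=> vp sp; apply/phi_ker; rewrite ?kq_valid_path //; apply: adm.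
have gens_long : {in rel_gens K (Q := Q) rel, forall g, kq_long 2 g}.
  by move=> g /mapP[[x y] _ ->].
have cardQ : (#|qV Q| + #|qA Q| = 2 * n)%N by rewrite !card_ord mul2n addnn.
split=> [[m [m_gt0]]|radA].
- rewrite triv_ext_presented => -[psi [psi_hom psi_surj psi_ker]].
  (* The number [m] of edges is a priori unrelated to [n]; this bound turns the estimate in [m] into
     one by the number of vertices and arrows of [Q]. *)
  have le_mn : (m <= n)%N.
    rewrite -(card_ord m) -(card_ord n).
    apply: (card_vertices_le phi_hom phi_surj phi_nil (Q' := brauer_quiver m)
      (gens' := brauer_rels K m)      _ _ psi_hom psi_surj) => [g|g|f vf /psi_ker]; last exact.
      exact: brauer_rels_valid.
    by move=> /brauer_rels_long /allP lg; apply/allP => x /lg; apply: leq_trans.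
  have dimA : (dim A <= #|qV Q| + #|qA Q|)%N.
    rewrite cardQ; apply: leq_trans (leq_mul (leqnn 2) le_mn).
    by apply: (brauer_dim_le psi_hom psi_surj) => f If; apply/psi_ker => //; case: If.
  have [d bd] := dim_rad_sq_zero_basis gens_long phi_hom phi_ker dimA.
  exact: (rszb_rad_sq_zero bd).
have aa0 x y : short_val phi (inr x) * short_val phi (inr y) = 0.
  by apply: radA; apply: (arrow_in_rad phi_hom phi_surj phi_nil).
have dimA := dim_of_aa0 phi_hom phi_surj aa0.
have [d bd] := dim_rad_sq_zero_basis gens_long phi_hom phi_ker dimA.
(* Each edge of the underlying cycle of [Q] gives one edge of the Brauer cycle, whatever its
   orientation. *)
exists n; split=> //; rewrite triv_ext_presented.
exists (cycle_map (short_val phi) d); split.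
- exact: cycle_map_hom.
- exact: cycle_map_surj.
- by move=> f; apply: cycle_map_ker.
Qed.
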